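(* Let $\lambda,\kappa,\lambda',\kappa'$ be regular infinite cardinals with $\lambda>\kappa$ and $\lambda'>\kappa'$. The following are equivalent. (1) $\lambda\le\lambda'$ and $\kappa\le\kappa'$. (2) Every partial order with the $(\lambda,\kappa)$-FN has the $(\lambda',\kappa')$-FN. (3) Every boolean algebra with the $(\lambda,\kappa)$-FN has the $(\lambda',\kappa')$-FN.
   Context: For infinite cardinals $\lambda\ge\kappa$, a partial order $P$ has the $(\lambda,\kappa)$-FN (the $(\lambda,\kappa)$-Freese-Nation property) iff there is a map $(f,g)\colon P\to[P]^{<\lambda}\times[P]^{<\kappa}$ such that for all $p\le q$ in $P$ there exist $r\in f(p)\cap g(q)$ with $p\le r\le q$ and $s\in g(p)\cap f(q)$ with $p\le s\le q$. Here $[P]^{<\mu}$ is the set of subsets of $P$ of cardinality less than $\mu$. A boolean algebra has the $(\lambda,\kappa)$-FN iff its underlying partial order does. *)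

(* Defs.v *)
From mathcomp Require Import all_boot all_order.
From mathcomp Require Import boolp classical_sets functions cardinality.
From mathcomp Require wochoice.

Set Implicit Arguments.
Unset Strict Implicit.
Unset Printing Implicit Defensive.

Local Open Scope classical_set_scope.
Local Open Scope card_scope.

Notation "A '#<' B" := ((A #<= B) && (A #!= B))
  (at level 79, format "A  '#<'  B") : card_scope.

(* A type L stands for the cardinal of [set: L]: every notion below is
   invariant under equipotence.  [initial_order R] says that the reflexive
   well-order R has the order type of the initial ordinal equipotent to L. *)
Definition initial_order (L : Type) (R : rel L) : Prop :=
  wochoice.well_order R /\
  forall x : L, [set y | R y x /\ y <> x] #< [set: L].

Definition cofinal (L : Type) (R : rel L) (A : set L) : Prop :=
  forall x : L, exists2 y, A y & R x y.

(* cf L = L, computed in the initial ordinal of L; the choice of R is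
   immaterial since any two initial orders on L are isomorphic. *)
Definition regular_cardinal (L : Type) : Prop :=
  infinite_set [set: L] /\
  exists2 R : rel L,
    initial_order R & forall A : set L, cofinal R A -> A #= [set: L].

(* Only the cardinalities of L and K matter here. *)
Definition FN (L K : Type) (d : Order.disp_t) (P : porderType d) : Prop :=
  exists f g : P -> set P,
    [/\ forall p, f p #< [set: L],
        forall p, g p #< [set: K]
      & forall p q : P, (p <= q)%O ->
          (exists r, [/\ f p r, g q r, (p <= r)%O & (r <= q)%O]) /\
          (exists s, [/\ g p s, f q s, (p <= s)%O & (s <= q)%O])].

(* Main.v *)
(* For (3) => (1), one Boolean algebra serves for both inequalities: the clopen
   algebra of the space obtained from the one-point compactification of the
   discrete space kap' and the Cantor cube 2^lam' by identifying the point at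
   infinity with the constant point 1.
   - It fails the (lam', kap')-FN: let y_l be the union of kap' and the clopen
     set {x | x l = 1} of the cube.  By regularity, some l lies outside the
     supports of all members of all f {k}, k in kap'.  An interpolant r in f {k}
     between {k} and y_l then omits the glued point, so it is a finite subset of
     kap'; hence g y_l contains fewer than kap' finite sets covering kap'.
   - It has the (lam, kap)-FN if lam' < lam, as its cardinality is below lam.
   - It has the (lam, kap)-FN if kap' < kap: fewer than kap elements have a given
     finite support in the cube, and A <= B is interpolated by an element whose
     support lies in those of both A and B. *)

From HB Require Import structures.
Require Import Defs.
From mathcomp Require Import all_boot all_order.
From mathcomp Require Import boolp classical_sets functions cardinality.

Local Open Scope classical_set_scope.
Local Open Scope card_scope.

Set Implicit Arguments.
Unset Strict Implicit.
Unset Printing Implicit Defensive.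

(** * Comparison of cardinals *)

(* Zorn's lemma, applied to partial injections seen as sets of pairs. *)
Lemma card_le_total (T U : Type) :
  [set: T] #<= [set: U] \/ [set: U] #<= [set: T].
Proof.
pose inj1 (G : set (T * U)) := forall p q, G p -> G q -> p.1 = q.1 -> p = q.
pose inj2 (G : set (T * U)) := forall p q, G p -> G q -> p.2 = q.2 -> p = q.
have [F FG Ftot|G [[G1 G2] Gmax]] :=
    @Zorn_bigcup _ (fun G => inj1 G /\ inj2 G).
  split=> p q [X FX Xp] [Y FY Yq].
    by have [XY|YX] := Ftot _ _ FX FY;
      [apply: (FG Y FY).1 => //; apply: XY|apply: (FG X FX).1 => //; apply: YX].
  by have [XY|YX] := Ftot _ _ FX FY;
    [apply: (FG Y FY).2 => //; apply: XY|apply: (FG X FX).2 => //; apply: YX].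
have E1 : [set p.1 | p in G] #= G.
  by apply: inj_card_eq => p q /set_mem Gp /set_mem Gq; apply: G1.
have E2 : [set p.2 | p in G] #= G.
  by apply: inj_card_eq => p q /set_mem Gp /set_mem Gq; apply: G2.
have [dom|/existsNP[a nGa]] := pselect (forall a, [set p.1 | p in G] a).
  left; have -> : [set: T] = [set p.1 | p in G].
    by apply/seteqP; split=> // a _; apply: dom.
  by rewrite (card_le_eql E1) -(card_le_eql E2); apply: card_leT.
have [cod|/existsNP[b nGb]] := pselect (forall b, [set p.2 | p in G] b).
  right; have -> : [set: U] = [set p.2 | p in G].
    by apply/seteqP; split=> // b _; apply: cod.
  by rewrite (card_le_eql E2) -(card_le_eql E1); apply: card_leT.
exfalso; apply: (Gmax (G `|` [set (a, b)])).
  split; first by move=> p Gp; left.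
  by move=> /(_ (a, b) (or_intror erefl)) Gab; apply: nGa; exists (a, b).
split=> p q [Gp|->] [Gq|->] //= E.
- exact: G1.
- by case: nGa; exists p.
- by case: nGa; exists q.
- exact: G2.
- by case: nGb; exists p.
- by case: nGb; exists q.
Qed.

(** By Cantor-Bernstein, equipotence is domination both ways; comparability rules out that neither
    holds. *)
Lemma card_ltNge (T U : Type) (A : set T) :
  (A #< [set: U]) = ~~ ([set: U] #<= A).
Proof.
have -> : (A #= [set: U]) = (A #<= [set: U]) && ([set: U] #<= A).
  by apply/idP/andP => [|[? ?]]; rewrite card_eqPle => // -[].
have [|UA] := boolP ([set: U] #<= A); first by rewrite andbT andbN.
have := card_le_total A U.
rewrite (card_le_eql (card_setT A)) (card_le_eqr (card_setT A)) (negPf UA).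
by case=> // ->.
Qed.

Lemma card_le_lt_trans (T U V : Type) (A : set T) (B : set U) :
  A #<= B -> B #< [set: V] -> A #< [set: V].
Proof.
by rewrite !card_ltNge => AB; apply: contra => VA; apply: card_le_trans VA AB.
Qed.

Lemma card_lt_le_trans (T U V : Type) (A : set T) :
  A #< [set: U] -> [set: U] #<= [set: V] -> A #< [set: V].
Proof.
by rewrite !card_ltNge => AU UV; apply: contra AU; apply: card_le_trans.
Qed.

(** * Regular cardinals *)

Lemma initial_order_total (L : Type) (R : rel L) : initial_order R -> total R.
Proof.
move=> [wo _] x y.
have [|z [[/asboolP[->|->] zmin] _]] := wo [pred a | `[< a = x \/ a = y >]].
- by exists x; apply/asboolP; left.
- by rewrite zmin //; apply/asboolP; right.
- by rewrite orbC zmin //; apply/asboolP; left.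
Qed.

Lemma card_leT_inj (T U : Type) (B : set U) :
  [set: T] #<= B -> exists2 f : T -> U, injective f & forall x, B (f x).
Proof.
move=> /card_leP[f]; exists (set_val \o f \o to_setT) => [x y /val_inj|x].
  by move=> /(inj (mem_set I) (mem_set I)) /(congr1 val).
exact: set_valP.
Qed.

Lemma regular_bigcup (M I T : Type) (F : I -> set T) (J : set I) :
  regular_cardinal M -> J #< [set: M] -> (forall i, J i -> F i #< [set: M]) ->
  \bigcup_(i in J) F i #< [set: M].
Proof.
(* If the union has size at least M, transport the F i to M along an injection
   h; each is bounded by some b i, and the b i are cofinal in M. *)
move=> [Minf [R Rinit Rcof]] JM FM; rewrite card_ltNge; apply/negP.
move=> /card_leT_inj[h h_inj hU].
have [m0 _] := infinite_setN0 Minf.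
have bnd i : exists b, J i -> forall x, F i (h x) -> ~~ R b x.
  have [Ji|nJi] := pselect (J i); last by exists m0.
  apply: contrapT => /forallNP nb.
  have : h @^-1` F i #= [set: M].
    apply: Rcof => b; have /not_implyP[_ /existsNP[x /not_implyP[]]] := nb b.
    by move=> Fx /negP/negPn Rbx; exists x.
  suff : h @^-1` F i #< [set: M] by move=> /andP[_ /negPf->].
  apply: card_le_lt_trans (FM i Ji).
  rewrite -(card_le_eql (inj_card_eq (in2W h_inj))).
  by apply: subset_card_le => _ [x Fx <-].
have [b bP] := choice bnd.
have : b @` J #= [set: M].
  apply: Rcof => x; have [i Ji Fi] := hU x; exists (b i); first by exists i.
  by have := initial_order_total Rinit (b i) x; rewrite (negPf (bP _ Ji _ Fi)).
suff : b @` J #< [set: M] by move=> /andP[_ /negPf->].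
exact: card_le_lt_trans (card_image_le _ _) JM.
Qed.

Lemma infinite_gt_finite (M T : Type) (A : set T) :
  infinite_set [set: M] -> finite_set A -> A #< [set: M].
Proof.
move=> Minf Afin; rewrite card_ltNge; apply/negP => /card_le_finite.
by move=> /(_ Afin).
Qed.

Lemma regular_setX (M T U : Type) (A : set T) (B : set U) :
  regular_cardinal M -> A #< [set: M] -> B #< [set: M] ->
  A `*` B #< [set: M].
Proof.
move=> Mreg AM BM.
have -> : A `*` B = \bigcup_(a in A) (pair a @` B).
  apply/seteqP; split=> [[a b] [/= Aa Bb]|_ [a Aa [b Bb <-]]//].
  by exists a => //; exists b.
apply: regular_bigcup => // a _.
exact: card_le_lt_trans (card_image_le _ _) BM.
Qed.

(** Sorting by length gives a countable union, small because [M] is regular and uncountable. *)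
Lemma regular_seq (M T : Type) :
  regular_cardinal M -> [set: nat] #< [set: M] -> [set: T] #< [set: M] ->
  [set: seq T] #< [set: M].
Proof.
move=> Mreg NM TM.
have -> : [set: seq T] = \bigcup_(n in [set: nat]) [set s | size s = n].
  by apply/seteqP; split=> // s _; exists (size s).
apply: regular_bigcup => // n _; elim: n => [|n IHn].
  apply: infinite_gt_finite; first by case: Mreg.
  by apply: sub_finite_set (finite_set1 [::]) => -[].
apply: card_le_lt_trans (regular_setX Mreg TM IHn).
apply: card_le_trans (card_image_le (fun p => p.1 :: p.2) _).
by apply: subset_card_le => -[//|x s] [sn]; exists (x, s).
Qed.

(** * The clopen algebra of the glued space *)

Section GluedAlgebra.
Variables K L : choiceType.
Local Notation point := (K + (L -> bool))%type.
Implicit Types (A B : set point) (s : seq L) (t : seq K).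

(* [inl k] is an isolated point, [inr] embeds the cube and [inr xpredT] is the
   glued point, to which the points [inl k] converge. *)
Definition cube_support A s :=
  forall x y : L -> bool, {in s, x =1 y} -> A (inr x) -> A (inr y).

(** This is clopenness at the glued point, seen from the isolated points. *)
Definition exceptional A t :=
  forall k, k \notin t -> (A (inl k) <-> A (inr xpredT)).

(** By compactness, the clopen subsets of the cube are those with a finite support. *)
Definition clopen : {pred set point} :=
  [pred A | `[< (exists s, cube_support A s) /\ (exists t, exceptional A t) >]].

Lemma clopenP A :
  reflect ((exists s, cube_support A s) /\ (exists t, exceptional A t))
    (A \in clopen).
Proof. exact: asboolP. Qed.

Lemma cube_support_sub A s s' :
  {subset s <= s'} -> cube_support A s -> cube_support A s'.
Proof. by move=> ss' As x y xy; apply: As => l /ss'; apply: xy. Qed.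

Lemma exceptional_sub A t t' :
  {subset t <= t'} -> exceptional A t -> exceptional A t'.
Proof. by move=> tt' At k kt'; apply: At; apply: contra kt' => /tt'. Qed.

Lemma clopen2 A B : A \in clopen -> B \in clopen -> exists s t,
  [/\ cube_support A s, cube_support B s, exceptional A t & exceptional B t].
Proof.
move=> /clopenP[[s As] [t At]] /clopenP[[s' Bs'] [t' Bt']].
exists (s ++ s'), (t ++ t'); split.
- by apply: cube_support_sub As => l; rewrite mem_cat => ->.
- by apply: cube_support_sub Bs' => l; rewrite mem_cat orbC => ->.
- by apply: exceptional_sub At => l; rewrite mem_cat => ->.
- by apply: exceptional_sub Bt' => l; rewrite mem_cat orbC => ->.
Qed.

Lemma clopenI A B : A \in clopen -> B \in clopen -> A `&` B \in clopen.
Proof.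
move=> /clopen2 /[apply] -[s [t [As Bs At Bt]]]; apply/clopenP; split.
  by exists s => x y xy [/(As _ _ xy) ? /(Bs _ _ xy) ?].
by exists t => k kt; rewrite /setI /= (propext (At k kt)) (propext (Bt k kt)).
Qed.

Lemma clopenC A : A \in clopen -> ~` A \in clopen.
Proof.
move=> /clopenP[[s As] [t At]]; apply/clopenP; split.
  (* Agreement on [s] is symmetric, so [y] in [A] would force [x] in [A]. *)
  by exists s => x y xy nAx /(As y x) Ax; apply/nAx/Ax => l /xy.
by exists t => k kt; rewrite /setC /= (propext (At k kt)).
Qed.

Lemma clopenU A B : A \in clopen -> B \in clopen -> A `|` B \in clopen.
Proof.
move=> /clopenC Ac /clopenC Bc.
by rewrite -(setCK A) -(setCK B) -setCI clopenC // clopenI.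
Qed.

Lemma clopen0 : set0 \in clopen.
Proof. by apply/clopenP; split; [exists [::] | exists [::]]. Qed.

Lemma clopenT : setT \in clopen.
Proof. by rewrite -setC0 clopenC // clopen0. Qed.

Record glued := Glued { glued_val :> set point; _ : glued_val \in clopen }.

HB.instance Definition _ := [isSub for glued_val].
HB.instance Definition _ := [Choice of glued by <:].
HB.instance Definition _ := Order.isTBLatticeClosed.Build _ _ clopen
  clopenI clopenU clopen0 clopenT.
HB.instance Definition _ :=
  [SubChoice_isTBSubLattice of glued by <: with set_display].

Fact glued_meetUl : @left_distributive glued glued Order.meet Order.join.
Proof. by move=> A B C; apply/val_inj/setIUl. Qed.

HB.instance Definition _ :=
  Order.Lattice_Meet_isDistrLattice.Build _ glued glued_meetUl.

Definition glued_compl (A : glued) : glued := Glued (clopenC (valP A)).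

Fact glued_joinxC (A : glued) : Order.join A (glued_compl A) = Order.top.
Proof. exact/val_inj/setUv. Qed.

Fact glued_meetxC (A : glued) : Order.meet A (glued_compl A) = Order.bottom.
Proof. exact/val_inj/setICr. Qed.

HB.instance Definition _ := Order.TBDistrLattice_hasComplement.Build _ glued
  glued_joinxC glued_meetxC.

Lemma glued_leP (A B : glued) : reflect (A `<=` B) (A <= B)%O.
Proof. exact: asboolP. Qed.

End GluedAlgebra.


(** * Counting and interpolating clopen sets *)

Section GluedFN.
Variables K L : choiceType.
Local Notation point := (K + (L -> bool))%type.
Local Notation glued := (glued K L).

(** A code for a set with support [s]: [c.1] lists the isolated points that deviate from the generic
    value [c.2.1], and [c.2.2] lists the restrictions to [s] of the points in the cube. Not every
    code yields a clopen set; for an upper bound, surjectivity suffices. *)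
Definition decode (s : seq L) (c : seq K * (bool * seq (seq bool))) :
    set point :=
  fun z => match z with
           | inl k => (k \in c.1) (+) c.2.1
           | inr x => map x s \in c.2.2
           end.

Lemma cube_support_decode s (A : glued) :
  cube_support A s -> exists c, decode s c = A.
Proof.
case: A => A /= /clopenP[_ [t At]] As.
pose b := `[< A (inr xpredT) >].
pose P v := `[< exists2 x, map x s = v & A (inr x) >].
(* Only points of [t] can deviate from [b]; the boolean tuples enumerate all possible restrictions
   to [s]. *)
exists ([seq k <- t | `[< A (inl k) >] (+) b],
  (b, [seq v <- map val (enum {: (size s).-tuple bool}) | P v])).
apply/seteqP; split=> -[k|x] /=; rewrite mem_filter.
- have [kt|/At kt] := boolP (k \in t); first by rewrite andbT addbK => /asboolP.
  by rewrite andbF => /asboolP /kt.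
- by move=> /andP[/asboolP[y /eq_in_map yx Ay] _]; apply: As Ay.
- have [kt|/At kt] := boolP (k \in t); first by rewrite andbT addbK => /asboolP.
  by rewrite andbF => /kt /asboolP.
- move=> Ax; apply/andP; split; first by apply/asboolP; exists x.
  apply/mapP; exists (map_tuple x (in_tuple s)); last by [].
  by rewrite mem_enum.
Qed.

Lemma card_cube_support (M : Type) s :
  regular_cardinal M -> [set: nat] #< [set: M] -> [set: K] #< [set: M] ->
  [set A : glued | cube_support A s] #< [set: M].
Proof.
move=> Mreg NM KM.
have codeM : [set: seq K * (bool * seq (seq bool))] #< [set: M].
  rewrite -setXTT; apply: regular_setX => //; first exact: regular_seq.
  exact: card_le_lt_trans (countableP _) NM.
apply: card_le_lt_trans codeM.
apply: card_le_trans (card_image_le (decode s) _).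
rewrite -(card_le_eql (inj_card_eq (in2W (@val_inj _ _ glued)))).
apply: subset_card_le => _ [A As <-].
by have [c cA] := cube_support_decode As; exists c.
Qed.

Lemma card_glued (M : Type) :
  regular_cardinal M -> [set: nat] #< [set: M] -> [set: K] #< [set: M] ->
  [set: L] #< [set: M] -> [set: glued] #< [set: M].
Proof.
move=> Mreg NM KM LM.
have -> : [set: glued] =
    \bigcup_(s in [set: seq L]) [set A : glued | cube_support A s].
  apply/seteqP; split=> // A _.
  by have /clopenP[[s As] _] := valP A; exists s.
apply: regular_bigcup => // [|s _]; first exact: regular_seq.
exact: card_cube_support.
Qed.

(** On the cube, the interpolant [E] is the saturation of [A] under agreement on [s']: it stays
    inside [B] because [B] has support [s']. *)
Lemma glued_interpolation (A B : glued) s s' :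
  cube_support A s -> cube_support B s' -> (A <= B)%O ->
  exists C : glued,
    [/\ cube_support C s, cube_support C s', (A <= C)%O & (C <= B)%O].
Proof.
move=> As Bs' /glued_leP AB.
have [_ [t [_ _ At Bt]]] := clopen2 (valP A) (valP B).
pose E x := exists2 y, {in s', y =1 x} & val A (inr y).
have AE x : val A (inr x) -> E x by exists x.
have EB x : E x -> val B (inr x) by move=> [y yx /AB]; apply: Bs'.
(* On isolated points, [C] copies [B] if [E] contains the glued point, which is then in [B], and
   otherwise [A], which then omits it. So almost all of them agree with the glued point. *)
pose C : set point := fun z => match z with
  | inl k => (E xpredT /\ val B (inl k)) \/ (~ E xpredT /\ val A (inl k))
  | inr x => E x
  end.
have Cs' : cube_support C s'.
  by move=> x x' xx' [y yx Ay]; exists y => // l ls; rewrite yx // xx'.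
have Cs : cube_support C s.
  move=> x x' xx' [y yx Ay].
  (* This hybrid agrees with [x'] on [s'] and with [y] on [s]. *)
  exists (fun l => if l \in s' then x' l else y l); first by move=> l ->.
  apply: As Ay => l ls; case: ifP => // ls'; by rewrite -xx' // yx.
have Cclopen : C \in @clopen K L.
  apply/clopenP; split; first by exists s.
  exists t => k kt /=; rewrite /C (propext (At k kt)) (propext (Bt k kt)).
  by split=> [[[]|[_ /AE]]//|ET]; left; split=> //; exact: EB.
exists (Glued Cclopen); split=> //; apply/glued_leP => -[k|x] /=.
- move=> Ak; have [ET|nET] := pselect (E xpredT); last by right.
  by left; split=> //; exact: AB.
- exact: AE.
- by move=> [[]|[_ /AB]].
- exact: EB.
Qed.

Lemma FN_glued (N M : Type) :
  regular_cardinal M -> [set: M] #<= [set: N] ->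
  [set: nat] #< [set: M] -> [set: K] #< [set: M] -> FN N M glued.
Proof.
move=> Mreg MN natM KM.
have /choice[s sP] (A : glued) : exists s, cube_support A s.
  by have /clopenP[] := valP A.
pose h (A : glued) := [set C : glued | cube_support C (s A)].
have hM A : h A #< [set: M] by exact: card_cube_support.
exists h, h; split=> // [A|A B AB]; first exact: card_lt_le_trans MN.
have [C [CA CB AC CB']] := glued_interpolation (sP A) (sP B) AB.
by split; exists C.
Qed.

Definition glued_atom_set (k : K) : set point := [set inl k].
(** This is y_l from the outline; it contains the glued point, as [xpredT l] holds. *)
Definition glued_upper_set (l : L) : set point :=
  fun z => if z is inr x then x l else True.

Lemma glued_atom_clopen k : glued_atom_set k \in @clopen K L.
Proof.
apply/clopenP; split; first by exists [::].
by exists [:: k] => k'; rewrite inE => /eqP kk'; split=> // -[].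
Qed.

Lemma glued_upper_clopen l : glued_upper_set l \in @clopen K L.
Proof.
apply/clopenP; split; last by exists [::].
by exists [:: l] => x y /(_ l (mem_head _ _)) /= ->.
Qed.

Definition glued_atom k : glued := Glued (glued_atom_clopen k).
Definition glued_upper l : glued := Glued (glued_upper_clopen l).

Lemma not_FN_glued :
  regular_cardinal K -> regular_cardinal L -> [set: K] #< [set: L] ->
  ~ FN L K glued.
Proof.
move=> Kreg Lreg KL [f [g [fL gK fg]]].
have /choice[s sP] (A : glued) : exists s, cube_support A s.
  by have /clopenP[] := valP A.
pose S := \bigcup_(A in \bigcup_k f (glued_atom k)) [set` s A].
have : S #< [set: L].
  apply: regular_bigcup => // [|A _]; first by apply: regular_bigcup.
  by apply: infinite_gt_finite; [case: Lreg | exact: finite_seq].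
rewrite card_ltNge => /negP LS.
have [l lS] : exists l, ~ S l.
  by apply/existsNP => SL; apply: LS; apply: subset_card_le => l _; exact: SL.
(* A clopen set omitting the glued point has only finitely many isolated points. *)
pose J := [set A | g (glued_upper l) A /\ ~ val A (inr xpredT)].
have JK : \bigcup_(A in J) [set k | val A (inl k)] #< [set: K].
  apply: regular_bigcup => // [|A [_ nAT]].
    apply: card_le_lt_trans (gK (glued_upper l)).
    by apply: subset_card_le => A [].
  apply: infinite_gt_finite; first by case: Kreg.
  have /clopenP[_ [t At]] := valP A.
  apply: sub_finite_set (finite_seq t) => k /= Ak.
  by apply: contrapT => /negP /At [/(_ Ak)].
suff JT : [set: K] `<=` \bigcup_(A in J) [set k | val A (inl k)].
  by move: JK; rewrite card_ltNge => /negP; apply; exact: subset_card_le.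
move=> k _.
have kl : (glued_atom k <= glued_upper l)%O by apply/glued_leP => _ ->.
have [[A [fA gA /glued_leP kA /glued_leP Al]] _] := fg _ _ kl.
exists A; last exact: kA.
split=> // AT.
(* Switching off coordinate [l] of the glued point stays in [A], whose support misses [l], but
   leaves y_l. *)
suff /Al : val A (inr (fun i => i != l)) by rewrite /= /glued_upper_set eqxx.
apply: sP AT => i isA; apply/esym/eqP => il; apply: lS.
by rewrite -il; exists A => //; exists k.
Qed.

End GluedFN.

(** * General facts on the property, and the equivalence *)

Lemma FN_small (N M : Type) (d : Order.disp_t) (P : porderType d) :
  infinite_set [set: M] -> [set: P] #< [set: N] -> FN N M P.
Proof.
(* With singletons for [g], the endpoints themselves interpolate. *)
move=> Minf PN; exists (fun=> setT), (fun p => [set p]); split=> // [p|p q pq].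
  by apply: infinite_gt_finite => //; exact: finite_set1.
by split; [exists q | exists p].
Qed.

Lemma FN_mono (N M N' M' : Type) (d : Order.disp_t) (P : porderType d) :
  [set: N] #<= [set: N'] -> [set: M] #<= [set: M'] -> FN N M P -> FN N' M' P.
Proof.
move=> NN' MM' [f [g [fN gM fg]]].
exists f, g; split=> // p.
  exact: card_lt_le_trans NN'.
exact: card_lt_le_trans MM'.
Qed.

Unset Implicit Arguments.

Theorem theorem2p5 (lam kap lam' kap' : Type)
    (lam_reg : regular_cardinal lam) (kap_reg : regular_cardinal kap)
    (lam'_reg : regular_cardinal lam') (kap'_reg : regular_cardinal kap')
    (kap_lt_lam : [set: kap] #< [set: lam])
    (kap'_lt_lam' : [set: kap'] #< [set: lam']) :
  [<-> ([set: lam] #<= [set: lam']) /\ ([set: kap] #<= [set: kap']);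
       forall (d : Order.disp_t) (P : porderType d),
         FN lam kap P -> FN lam' kap' P;
       forall (d : Order.disp_t) (B : ctbDistrLatticeType d),
         FN lam kap B -> FN lam' kap' B].
Proof.
(* Hence every cardinal strictly above [kap'] is uncountable, as the counting lemmas require. *)
have nat_le_kap' : [set: nat] #<= [set: kap'] by apply/infiniteP; case: kap'_reg.
tfae.
- by move=> [lam_le kap_le] d P; exact: FN_mono.
- by move=> FNP d B; exact: FNP.
(* [{classic _}] supplies the choice structures. If either inequality fails, comparability gives the
   reverse strict one, and the algebra has the property it should lack. *)
- move=> /(_ _ (glued {classic kap'} {classic lam'})) FNB.
  have nFN : ~ FN lam kap (glued {classic kap'} {classic lam'}).
    by move=> /FNB; exact: not_FN_glued.
  split; apply: contrapT => /negP; rewrite -card_ltNge => lt; apply: nFN.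
  + have kap'_lt : [set: kap'] #< [set: lam].
      by apply: card_le_lt_trans lt; case/andP: kap'_lt_lam'.
    apply: FN_small; first by case: kap_reg.
    by apply: card_glued => //; exact: card_le_lt_trans kap'_lt.
  + apply: FN_glued => //; first by case/andP: kap_lt_lam.
    exact: card_le_lt_trans lt.
Qed.
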